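(* Let $n \geq 1$ and $s \geq 1$ be integers, let $\lambda_0 \geq 0 > \lambda_1 \geq \cdots \geq \lambda_n$ be real numbers and let $z_1, \ldots, z_{2s}$ be complex numbers with $z_j = a_j + b_j i$, $a_j \in \mathbb{R}$, $b_j > 0$ for $j = 1, \ldots, 2s$. If $\lambda_0 + \sum_{j=1}^n \lambda_j - 2\sum_{j=1}^{2s} |z_j| \geq 0$, then there is an $(n+4s+1) \times (n+4s+1)$ normal centrosymmetric nonnegative matrix with eigenvalues $\lambda_0, \lambda_1, \ldots, \lambda_n, z_1, \ldots, z_{2s}, \overline{z}_1, \ldots, \overline{z}_{2s}$.
   Context: $J$ denotes the reverse identity matrix of the appropriate size (ones on the anti-diagonal, zeros elsewhere). A square matrix $Q$ is centrosymmetric if $JQJ = Q$, nonnegative if all entries are nonnegative, and normal if $QQ^* = Q^*Q$. *)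

(* Defs.v *)
From HB Require Import structures.
From mathcomp Require Import all_boot all_order all_algebra.
From mathcomp Require Import reals.
From mathcomp Require Import complex.
Set Implicit Arguments. Unset Strict Implicit. Unset Printing Implicit Defensive.
Import Order.TTheory GRing.Theory Num.Theory.
Local Open Scope ring_scope.

Definition revid (R : pzRingType) (n : nat) : 'M[R]_n :=
  \matrix_(i < n, j < n) ((i + j == n.-1)%N)%:R.

Definition centrosymmetric (R : pzRingType) (n : nat) (Q : 'M[R]_n) : Prop :=
  revid R n *m Q *m revid R n = Q.

Definition nonneg_mx (R : numDomainType) (m n : nat) (Q : 'M[R]_(m, n)) : Prop :=
  forall i j, 0 <= Q i j.

(* A real matrix is normal: Q Q^* = Q^* Q, and Q^* = Q^T for real Q. *)
Definition normal_real_mx (R : pzRingType) (n : nat) (Q : 'M[R]_n) : Prop :=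
  Q *m Q^T = Q^T *m Q.

(* Main.v *)
(* Conjugating by an orthogonal matrix splits a centrosymmetric matrix into a block P
   acting on the vectors fixed by J and a block M acting on the vectors negated by J; the
   matrix is nonnegative as soon as |M| <= P entrywise (up to a possible central row,
   which meets only P).  Both blocks are built by induction.  Starting from a 1 x 1
   block, each step consumes two negative eigenvalues mu, nu, or two of the z_j, one in
   each block: M grows by a direct sum with [nu], resp. [[a', b'], [-b', a']], whereas P
   is glued along its unit Perron vector u, of eigenvalue alpha, to a small normal matrix
   K with K_00 = alpha:
   P' = [[P, u c^T], [d u^T, C]] for K = [[alpha, c^T], [d, C]].
   Gluing removes alpha from the spectrum of P and adds that of K.  For a complex pair
   a +- ib, K = t w w^T + a I + b [w]_x with a unit vector w = (w0, w1, w1), and w0 is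
   chosen so that K dominates the new block of M while the Perron root increases by at
   least 2|z| + 2|z'|. *)
Require Import Defs.
From HB Require Import structures.
From mathcomp Require Import all_boot all_order all_algebra.
From mathcomp Require Import reals ring lra zify.
From mathcomp Require Import complex.
Set Implicit Arguments. Unset Strict Implicit. Unset Printing Implicit Defensive.
Import Order.TTheory GRing.Theory Num.Theory.
Local Open Scope ring_scope.

(** * Characteristic polynomials, and gluing along a unit eigenvector *)

Lemma char_poly_block_diag (R : comNzRingType) (a b : nat) (A : 'M[R]_a) (B : 'M[R]_b) :
  char_poly (block_mx A 0 0 B) = char_poly A * char_poly B.
Proof. by rewrite /char_poly char_block_diag_mx det_ublock. Qed.

Lemma char_poly_conj (R : comNzRingType) (a : nat) (V W D : 'M[R]_a) :
  W *m V = 1%:M -> char_poly (V *m D *m W) = char_poly D.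
Proof.
move=> WV1; rewrite /char_poly /char_poly_mx.
have VW1 : V *m W = 1%:M by apply: mulmx1C.
have -> : 'X%:M - map_mx polyC (V *m D *m W)
  = map_mx polyC V *m ('X%:M - map_mx polyC D) *m map_mx polyC W.
  rewrite mulmxBr mulmxBl !map_mxM scalar_mxC -(mulmxA 'X%:M) -!map_mxM VW1.
  by rewrite map_mx1 mulmx1.
by rewrite !det_mulmx mulrAC -det_mulmx -map_mxM VW1 map_mx1 det1 mul1r.
Qed.

Lemma char_poly_scalar1 (R : comNzRingType) (x : R) :
  char_poly (x%:M : 'M_1) = 'X - x%:P.
Proof. by rewrite /char_poly det_mx11 !mxE eqxx. Qed.

Definition glue_mx (R : pzRingType) (a k : nat) (P : 'M[R]_a) (u : 'cV[R]_a)
    (c d : 'cV[R]_k) (C : 'M[R]_k) : 'M[R]_(a + k) :=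
  block_mx P (u *m c^T) (d *m u^T) C.

(* Column operations with the eigenvector [u] clear the upper right block. *)
Lemma char_poly_glue_mx (R : comNzRingType) (a k : nat) (P : 'M[R]_a)
    (u : 'cV[R]_a) (alpha : R) (c d : 'cV[R]_k) (C : 'M[R]_k) :
  P *m u = alpha *: u -> u^T *m u = 1%:M ->
  char_poly (glue_mx P u c d C) * ('X - alpha%:P) ^+ k =
  char_poly P * \det (('X - alpha%:P) *: char_poly_mx C
                      - map_mx polyC d *m map_mx polyC c^T).
Proof.
move=> Pu uu; set y := 'X - alpha%:P.
pose E : 'M[{poly R}]_(a + k) :=
  block_mx 1%:M (map_mx polyC u *m map_mx polyC c^T) 0 y%:M.
have detE : \det E = y ^+ k by rewrite det_ublock det1 mul1r det_scalar.
have Pu' : map_mx polyC P *m map_mx polyC u = alpha%:P *: map_mx polyC u.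
  by rewrite -map_mxM Pu map_mxZ.
have uu' : map_mx polyC u^T *m map_mx polyC u = 1%:M by rewrite -map_mxM uu map_mx1.
rewrite -detE -det_mulmx -(det_lblock _ (- map_mx polyC (d *m u^T))); congr (\det _).
rewrite /E /char_poly_mx /glue_mx map_block_mx scalar_mx_block opp_block_mx.
rewrite add_block_mx mulmx_block !mulmx1 !mulmx0 !addr0 !sub0r !map_mxM /=.
congr block_mx.
  rewrite mulmxA mulmxBl Pu' mul_scalar_mx -scalerBl mul_mx_scalar scalerN scalemxAl.
  exact: subrr.
rewrite mulNmx -mulmxA (mulmxA (map_mx _ u^T)) uu' mul1mx.
by rewrite mul_mx_scalar addrC.
Qed.

(** The determinant on the right of [char_poly_glue_mx] involves neither [P] nor [u]. It can thus be
    evaluated for the 1 x 1 block [alpha] with [u = 1], where gluing returns the small block matrix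
    itself; the power of ['X - alpha%:P] then cancels in the integral domain. *)
Lemma char_poly_glue_factor (R : idomainType) (a k : nat) (P : 'M[R]_a)
    (u : 'cV[R]_a) (alpha : R) (c d : 'cV[R]_k) (C : 'M[R]_k) (p : {poly R}) :
  P *m u = alpha *: u -> u^T *m u = 1%:M ->
  char_poly P = ('X - alpha%:P) * p ->
  char_poly (glue_mx P u c d C) =
  p * char_poly (block_mx (alpha%:M : 'M_1) c^T d C).
Proof.
move=> Pu uu charP.
have y0 : 'X - alpha%:P != 0 by rewrite polyXsubC_eq0.
apply: (mulIf (expf_neq0 k y0)).
rewrite (char_poly_glue_mx _ _ _ Pu uu) charP -mulrA mulrCA -mulrA.
have := @char_poly_glue_mx R 1 k alpha%:M 1%:M alpha c d C.
rewrite /glue_mx mul1mx trmx1 !mulmx1 => -> //; last by rewrite scalemx1.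
by rewrite char_poly_scalar1.
Qed.

(** As [u] is a unit eigenvector of both [P] and [P^T], each block of the normality equation follows
    from the matching block for the small matrix, with factors [u] and [u^T] inserted; the upper
    left block also uses the normality of [P]. *)
Lemma normal_glue_mx (R : comNzRingType) (a k : nat) (P : 'M[R]_a)
    (u : 'cV[R]_a) (alpha : R) (c d : 'cV[R]_k) (C : 'M[R]_k) :
  P *m u = alpha *: u -> P^T *m u = alpha *: u -> u^T *m u = 1%:M ->
  normal_real_mx P -> normal_real_mx (block_mx (alpha%:M : 'M_1) c^T d C) ->
  normal_real_mx (glue_mx P u c d C).
Proof.
rewrite /normal_real_mx /glue_mx => Pu PTu uu nP.
rewrite !tr_block_mx !mulmx_block tr_scalar_mx trmxK.
case/eq_block_mx => /addrI e1 e2 e3 e4.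
rewrite !trmx_mul !trmxK !mulmxA; congr block_mx.
- by rewrite nP -(mulmxA u c^T c) -(mulmxA u d^T d) e1.
- rewrite Pu PTu -!mulmxA -!scalemxAl -!mul_mx_scalar -!mulmxA.
  rewrite -!mulmxDr; congr (u *m _).
  by rewrite !scalar_mxC.
- have uP : u^T *m P = alpha *: u^T by rewrite -[P]trmxK -trmx_mul PTu linearZ.
  have uPT : u^T *m P^T = alpha *: u^T by rewrite -trmx_mul Pu linearZ.
  rewrite -(mulmxA d) uPT -(mulmxA c) uP -!scalemxAr !scalemxAl -!mulmxDl.
  by congr (_ *m _); rewrite -!mul_mx_scalar.
- by rewrite -!(mulmxA _ u^T) uu !mulmx1.
Qed.

(** * Dominated pairs of blocks and their growth by gluing *)

Definition perron_vector (R : numDomainType) (a : nat) (P : 'M[R]_a) (alpha : R)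
    (u : 'cV[R]_a) : Prop :=
  [/\ P *m u = alpha *: u, P^T *m u = alpha *: u, u^T *m u = 1%:M & nonneg_mx u].

(* Index [0] of [P] is the central row when the final size is odd; when it is even, [M]
   is completed by an entry of absolute value [l] at that index. *)
Definition sym_skew_pair (R : numDomainType) (m : nat) (l alpha : R) (p q : {poly R})
    (P : 'M[R]_(1 + m)) (M : 'M[R]_m) : Prop :=
  [/\ normal_real_mx P /\ normal_real_mx M,
      nonneg_mx P /\ l <= P 0 0,
      forall i j, `|M i j| <= P (rshift 1 i) (rshift 1 j),
      exists u, perron_vector P alpha u &
      char_poly P = ('X - alpha%:P) * p /\ char_poly M = q].

(** The Perron root stays free above [S]: to reach a prescribed root [beta], a gluing step must be
    able to request the smaller pair with whatever root [alpha] sits in the corner of [K]. *)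
Definition realizable (R : numDomainType) (m : nat) (l S : R) (p q : {poly R}) : Prop :=
  forall alpha, S <= alpha -> exists P M, @sym_skew_pair R m l alpha p q P M.

Lemma nonneg_block_mx (R : numDomainType) (m1 m2 n1 n2 : nat) (A : 'M[R]_(m1, n1))
    (B : 'M[R]_(m1, n2)) (C : 'M[R]_(m2, n1)) (D : 'M[R]_(m2, n2)) :
  nonneg_mx A -> nonneg_mx B -> nonneg_mx C -> nonneg_mx D ->
  nonneg_mx (block_mx A B C D).
Proof.
move=> hA hB hC hD i j.
by case: (split_ordP i) => k ->; case: (split_ordP j) => h ->;
  rewrite ?block_mxEul ?block_mxEur ?block_mxEdl ?block_mxEdr.
Qed.

Lemma nonneg_mul_mx (R : numDomainType) (a b c : nat) (A : 'M[R]_(a, b))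
    (B : 'M[R]_(b, c)) : nonneg_mx A -> nonneg_mx B -> nonneg_mx (A *m B).
Proof. by move=> hA hB i j; rewrite mxE sumr_ge0 // => k _; rewrite mulr_ge0. Qed.

Lemma nonneg_tr_mx (R : numDomainType) (a b : nat) (A : 'M[R]_(a, b)) :
  nonneg_mx A -> nonneg_mx A^T.
Proof. by move=> hA i j; rewrite mxE. Qed.

(** Let [E] be the block diagonal matrix with blocks [u] and the identity. Then [E^T E = 1], and [E]
    intertwines the small matrix with the glued one, as well as their transposes; the new vector is
    the image under [E] of the small Perron vector. *)
Lemma perron_vector_glue (R : numDomainType) (a k : nat) (P : 'M[R]_a) (u : 'cV[R]_a)
    (alpha beta w0 : R) (c d w1 : 'cV[R]_k) (C : 'M[R]_k) :
  perron_vector P alpha u ->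
  perron_vector (block_mx (alpha%:M : 'M_1) c^T d C) beta (col_mx w0%:M w1) ->
  perron_vector (glue_mx P u c d C) beta (col_mx (w0 *: u) w1).
Proof.
have key (v y : 'cV[R]_k) : alpha%:M *m w0%:M + v^T *m y = beta *: (w0%:M : 'M_1) ->
    w0 *: (alpha *: u) + u *m v^T *m y = beta *: (w0 *: u).
  move/(congr1 (mulmx u)); rewrite mulmxDr -scalar_mxM !mul_mx_scalar mulmxA => e.
  by rewrite scalerA mulrC e -scalemxAr mul_mx_scalar.
case=> Pu PTu uu u0 [Cw CTw ww w_ge0]; move: Cw CTw ww; rewrite /glue_mx.
rewrite !tr_block_mx !mul_block_col !tr_col_mx !mul_row_col !tr_scalar_mx trmxK.
rewrite !scale_col_mx => /eq_col_mx [e1 e2] /eq_col_mx [f1 f2] e3; split.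
- rewrite mul_block_col scale_col_mx -!scalemxAr Pu (key _ _ e1) -mulmxA uu mulmx1.
  by rewrite -e2 mul_mx_scalar.
- rewrite tr_block_mx mul_block_col scale_col_mx !trmx_mul !trmxK -!scalemxAr PTu (key _ _ f1).
  by rewrite -mulmxA uu mulmx1 -f2 mul_mx_scalar.
- rewrite tr_col_mx mul_row_col [(w0 *: u)^T]linearZ /= -scalemxAl -scalemxAr uu scalemx1 -e3.
  by rewrite mul_scalar_mx.
- move=> i j; rewrite ord1; case: (split_ordP i) => h ->.
    rewrite col_mxEu mxE mulr_ge0 //.
    by have := w_ge0 (lshift k 0) 0; rewrite col_mxEu mxE eqxx.
  by have := w_ge0 (rshift 1 h) 0; rewrite !col_mxEd.
Qed.

(** [M] grows by a direct sum, so its new off-diagonal blocks vanish and domination there only asks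
    that [u c^T] and [d u^T] be nonnegative. The corner entry [P 0 0] is untouched, which preserves
    the bound [l]. *)
Lemma sym_skew_pair_glue (R : numFieldType) (m k : nat) (l S alpha beta : R)
    (p q r : {poly R}) (c d w1 : 'cV[R]_k) (w0 : R) (C B : 'M[R]_k) :
  realizable m l S p q -> S <= alpha ->
  normal_real_mx (block_mx (alpha%:M : 'M_1) c^T d C) -> normal_real_mx B ->
  perron_vector (block_mx (alpha%:M : 'M_1) c^T d C) beta (col_mx w0%:M w1) ->
  nonneg_mx c -> nonneg_mx d -> (forall i j, `|B i j| <= C i j) ->
  char_poly (block_mx (alpha%:M : 'M_1) c^T d C) = ('X - beta%:P) * r ->
  exists P M, @sym_skew_pair R (m + k) l beta (p * r) (q * char_poly B) P M.
Proof.
move=> hr Sa nC nB [Cw CTw ww w_ge0] c0 d0 BC charC.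
have [P [M [[nP nM] [P0 Pl] MP [u [Pu PTu uu u0]] [charP charM]]]] := hr _ Sa.
have C0 : nonneg_mx C by move=> i j; apply: le_trans (BC i j).
exists (glue_mx P u c d C), (block_mx M 0 0 B); split.
- split; first exact: normal_glue_mx Pu PTu uu nP nC.
  rewrite /normal_real_mx tr_block_mx !mulmx_block !trmx0 !mulmx0 !mul0mx.
  by rewrite !addr0 !add0r nM nB.
- split.
    by apply: (@nonneg_block_mx _ (1 + m) k (1 + m) k) => //;
      apply: nonneg_mul_mx => //; apply: nonneg_tr_mx.
  rewrite -(block_mxEul P (u *m c^T) (d *m u^T) C 0 0) in Pl.
  have e0 : lshift k 0 = 0 :> 'I_(1 + (m + k)) by apply: val_inj.
  by rewrite e0 in Pl.
(* The sizes [1 + (m + k)] and [(1 + m) + k] are convertible; these equations translate the indices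
   of the first splitting into those of the second. *)
- have shl (i : 'I_m) : rshift 1 (lshift k i) = lshift k (rshift 1 i) :> 'I_((1 + m) + k).
    exact: val_inj.
  have shr (i : 'I_k) : rshift 1 (rshift m i) = rshift (1 + m) i :> 'I_((1 + m) + k).
    exact: val_inj.
  have uc := nonneg_mul_mx u0 (nonneg_tr_mx c0).
  have du := nonneg_mul_mx d0 (nonneg_tr_mx u0).
  move=> i j; case: (split_ordP i) => i' ->; case: (split_ordP j) => j' ->;
  rewrite ?block_mxEul ?block_mxEur ?block_mxEdl ?block_mxEdr.
  + by have := MP i' j'; rewrite /glue_mx !shl (@block_mxEul _ (1 + m) k (1 + m) k).
  + by rewrite /glue_mx shl shr (@block_mxEur _ (1 + m) k (1 + m) k) mxE normr0.
  + by rewrite /glue_mx shl shr (@block_mxEdl _ (1 + m) k (1 + m) k) mxE normr0.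
  + by rewrite /glue_mx !shr (@block_mxEdr _ (1 + m) k (1 + m) k).
- by exists (col_mx (w0 *: u) w1); apply: (@perron_vector_glue _ (1 + m) k _ _ alpha).
- split; first by rewrite (char_poly_glue_factor c d C Pu uu charP) charC mulrCA.
  by rewrite char_poly_block_diag charM.
Qed.

Lemma realizable_glue (R : numFieldType) (m k : nat) (l S beta : R)
    (p q r : {poly R}) (K : 'M[R]_(1 + k)) (B : 'M[R]_k) (w : 'cV[R]_(1 + k)) :
  realizable m l S p q -> S <= K 0 0 ->
  normal_real_mx K -> normal_real_mx B -> nonneg_mx K -> perron_vector K beta w ->
  (forall i j, `|B i j| <= K (rshift 1 i) (rshift 1 j)) ->
  char_poly K = ('X - beta%:P) * r ->
  exists P M, @sym_skew_pair R (m + k) l beta (p * r) (q * char_poly B) P M.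
Proof.
move=> hr SK nK nB K0 Kw BK charK.
have eK : K = block_mx (K 0 0)%:M (ursubmx K)^T^T (dlsubmx K) (drsubmx K).
  rewrite trmxK -[LHS]submxK; congr block_mx; rewrite [LHS]mx11_scalar !mxE.
  by congr (K _ _)%:M; apply: val_inj.
have ew : w = col_mx (w 0 0)%:M (dsubmx w).
  rewrite -[LHS]vsubmxK; congr col_mx; rewrite [LHS]mx11_scalar !mxE.
  by congr (w _ _)%:M; apply: val_inj.
rewrite eK in nK Kw charK; rewrite ew in Kw.
apply: (sym_skew_pair_glue hr SK nK nB Kw _ _ _ charK).
- by move=> i j; rewrite !mxE.
- by move=> i j; rewrite !mxE.
- by move=> i j; rewrite !mxE.
Qed.

(** * The small matrices used in the inductive steps *)

Lemma char_poly2 (R : comNzRingType) (K : 'M[R]_2) :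
  char_poly K = ('X - (K 0 0)%:P) * ('X - (K 1 1)%:P) - (K 0 1)%:P * (K 1 0)%:P.
Proof.
(* Naming entries by natural numbers identifies ordinals that differ only in their bound proofs, so
   that [ring] sees equal atoms. *)
pose k a b := K (inord a) (inord b).
have kE i j : K i j = k i j by rewrite /k !inord_val.
rewrite /char_poly (expand_det_row _ 0) !big_ord_recl big_ord0 /cofactor !det_mx11.
by rewrite !mxE !kE /=; ring.
Qed.

Lemma char_poly3 (R : comNzRingType) (K : 'M[R]_3) (k := fun a b => K (inord a) (inord b)) :
  char_poly K =
    ('X - (k 0 0)%:P) * ('X - (k 1 1)%:P) * ('X - (k 2 2)%:P)
    - (k 0 1)%:P * (k 1 2)%:P * (k 2 0)%:P - (k 0 2)%:P * (k 2 1)%:P * (k 1 0)%:P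
    - ('X - (k 0 0)%:P) * (k 1 2)%:P * (k 2 1)%:P
    - ('X - (k 1 1)%:P) * (k 0 2)%:P * (k 2 0)%:P
    - ('X - (k 2 2)%:P) * (k 0 1)%:P * (k 1 0)%:P.
Proof.
have kE i j : K i j = k i j by rewrite /k !inord_val.
rewrite /char_poly (expand_det_row _ 0) !big_ord_recl big_ord0 /cofactor.
rewrite !(expand_det_row _ 0) !big_ord_recl !big_ord0 /cofactor !det_mx11.
by rewrite !mxE !kE /=; ring.
Qed.

Definition mx_of_rows (R : pzRingType) (m n : nat) (s : seq (seq R)) : 'M[R]_(m, n) :=
  \matrix_(i < m, j < n) (nth [::] s i)`_j.

(** The symmetric matrix [K] with diagonal [alpha], [- nu] must have eigenvalues [beta] and [mu].
    The trace forces [alpha = beta + mu + nu], and the determinant forces the square of the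
    off-diagonal entry [rho]. The corner [- nu] dominates the new entry [nu] of [M] with
    equality. *)
Lemma realizable_real_pair (R : rcfType) (m : nat) (l S mu nu : R) (p q : {poly R}) :
  0 <= S -> mu < 0 -> nu < 0 -> realizable m l S p q ->
  realizable (m + 1) l (S - mu - nu) (p * ('X - mu%:P)) (q * ('X - nu%:P)).
Proof.
move=> S0 mu0 nu0 hr beta Sbeta; pose alpha := beta + mu + nu.
have alphaS : S <= alpha by rewrite /alpha; lra.
have rho2 : 0 <= - (alpha * nu) - beta * mu by rewrite /alpha; nra.
pose rho := Num.sqrt (- (alpha * nu) - beta * mu).
pose g := Num.sqrt (rho ^+ 2 + (- mu - nu) ^+ 2).
have g2 : g ^+ 2 = rho ^+ 2 + (- mu - nu) ^+ 2 by rewrite sqr_sqrtr // addr_ge0 ?sqr_ge0.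
have rhoE : rho ^+ 2 = - (alpha * nu) - beta * mu by rewrite sqr_sqrtr.
have g0 : 0 < g by rewrite sqrtr_gt0; have := sqr_ge0 rho; nra.
have rho0 : 0 <= rho := sqrtr_ge0 _.
pose K : 'M[R]_(1 + 1) := mx_of_rows 2 2 [:: [:: alpha; rho]; [:: rho; - nu]].
(* The first row of [(K - beta) w = 0] makes [w] proportional to [(rho, - mu - nu)]; [g] is its
   length. *)
pose w : 'cV[R]_(1 + 1) := mx_of_rows 2 1 [:: [:: rho / g]; [:: (- mu - nu) / g]].
rewrite -(char_poly_scalar1 nu).
apply: (@realizable_glue _ m 1 l S beta p q ('X - mu%:P) K nu%:M w hr).
- by rewrite mxE.
- by congr (_ *m _); apply/matrixP => -[[|[|//]] ?] [[|[|//]] ?]; rewrite !mxE.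
- by rewrite /normal_real_mx tr_scalar_mx.
- by move=> [[|[|//]] ?] [[|[|//]] ?]; rewrite !mxE /=; lra.
- have KT : K^T = K by apply/matrixP => -[[|[|//]] ?] [[|[|//]] ?]; rewrite !mxE.
  have Kw : K *m w = beta *: w.
    apply/matrixP => -[[|[|//]] ?] j; rewrite !mxE !big_ord_recl big_ord0 !mxE ord1 /= /alpha.
      by ring.
    have -> : rho * (rho / g) = rho ^+ 2 / g by rewrite mulrA.
    by rewrite rhoE /alpha; ring.
  split; rewrite ?KT //.
    apply/matrixP => i j; rewrite !mxE !big_ord_recl big_ord0 !mxE !ord1 /=.
    by rewrite ?eqxx ?mulr1n addr0 -!expr2 !expr_div_n -mulrDl -g2 divff // expf_neq0 ?gt_eqF.
  move=> [[|[|//]] ?] j; rewrite !mxE ord1 /=; apply: divr_ge0; rewrite ?(ltW g0) //; lra.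
- by move=> i j; rewrite !ord1 !mxE /= mulr1n ler0_norm // ltW.
- rewrite char_poly2 !mxE /= -[_ * rho%:P]rmorphM /= -expr2 rhoE /alpha.
  by rewrite !(rmorphD, rmorphB, rmorphN, rmorphM) /=; ring.
Qed.

(* With [p = t * w1 ^+ 2], one takes [p = r + r'] if this leaves [b <= t * w0], and
   [w0 = b / t] otherwise. *)
Lemma exists_mixing_weights (R : rcfType) (a b r r' S t : R) :
  t = S + 2 * r + 2 * r' - a ->
  0 < b -> 0 <= r -> a ^+ 2 + b ^+ 2 = r ^+ 2 -> 0 <= r' -> 0 <= S ->
  exists w0 w1, [/\ 0 <= w0 /\ 0 <= w1, w0 ^+ 2 + 2 * w1 ^+ 2 = 1,
    S <= t * w0 ^+ 2 + a /\ b <= t * w0,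
    r' <= t * w1 ^+ 2 + a & r' <= t * w1 ^+ 2 - b * w0].
Proof.
move=> tE b0 r0 abr r'0 S0.
have ar : a <= r by nra.
have ar' : - r <= a by nra.
have br : b <= r by nra.
have t0 : 0 < t by lra.
(* With [t * w1 ^+ 2 = r + r'], the unit length condition gives [t * w0 ^+ 2 = S - a]; the test is
   then exactly [b <= t * w0], squared. *)
have [hS|hS] := lerP (b ^+ 2) (t * (S - a)).
  have Sa : 0 <= S - a.
    by rewrite -(pmulr_rge0 _ t0); apply: le_trans hS; apply: sqr_ge0.
  exists (Num.sqrt ((S - a) / t)), (Num.sqrt ((r + r') / t)).
  have w0E : Num.sqrt ((S - a) / t) ^+ 2 = (S - a) / t.
    by rewrite sqr_sqrtr // divr_ge0 // ltW.
  have w1E : Num.sqrt ((r + r') / t) ^+ 2 = (r + r') / t.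
    by rewrite sqr_sqrtr // divr_ge0 ?addr_ge0 // ltW.
  have tw x : t * (x / t) = x by rewrite mulrC divfK ?gt_eqF.
  have w0_le1 : Num.sqrt ((S - a) / t) <= 1.
    by rewrite -sqrtr1 ler_wsqrtr // ler_pdivrMr // mul1r; lra.
  rewrite w0E w1E !tw; split; rewrite ?sqrtr_ge0 //.
  - by rewrite mulrA -mulrDl -[RHS](divff (lt0r_neq0 t0)); congr (_ / _); lra.
  - split; first lra.
    rewrite -(ler_pXn2r (_ : 0 < 2)%N) ?nnegrE ?mulr_ge0 ?sqrtr_ge0 ?(ltW t0) ?(ltW b0) //.
    by rewrite exprMn w0E expr2 -mulrA tw.
  - lra.
  - by nra.
have tb : b <= t by lra.
have t2 : 0 <= (t ^+ 2 - b ^+ 2) / (2 * t ^+ 2) by apply: divr_ge0; nra.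
exists (b / t), (Num.sqrt ((t ^+ 2 - b ^+ 2) / (2 * t ^+ 2))).
rewrite sqr_sqrtr //; split.
- by split; rewrite ?sqrtr_ge0 // divr_ge0 // ltW.
- by field; apply: lt0r_neq0.
- split; last by rewrite mulrC divfK ?gt_eqF.
  have -> : t * (b / t) ^+ 2 + a = b ^+ 2 / t + a by field; apply: lt0r_neq0.
  by rewrite -lerBlDr ler_pdivlMr // mulrC ltW.
- have -> : t * ((t ^+ 2 - b ^+ 2) / (2 * t ^+ 2)) + a
      = (t ^+ 2 - b ^+ 2 + 2 * t * a) / (2 * t) by field; apply: lt0r_neq0.
  rewrite ler_pdivlMr ?mulr_gt0 //.
  (* Clearing denominators leaves [b ^+ 2 <= t * (t - 2 * r' + 2 * a)]. As [0 <= S], the product is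
     at least [4 r^2 - a^2], which exceeds [r^2 - a^2 = b^2]. *)
  have : (2 * r - a) * (2 * r + a) <= t * (t - 2 * r' + 2 * a).
    by apply: ler_pM; lra.
  nra.
- have -> : t * ((t ^+ 2 - b ^+ 2) / (2 * t ^+ 2)) - b * (b / t)
      = (t ^+ 2 - 3 * b ^+ 2) / (2 * t) by field; apply: lt0r_neq0.
  rewrite ler_pdivlMr ?mulr_gt0 //.
  have : (2 * r - a) * (2 * r - a) <= t * (t - 2 * r') by apply: ler_pM; lra.
  (* The required bound is [3 b^2 <= (2r - a)^2], and the difference of the two sides is
     [(r - 2a)^2]. *)
  have := sqr_ge0 (r - 2 * a).
  nra.
Qed.

(** The real form of [(X - z)(X - conj z)], where [z] has real part [a] and modulus [r]. *)
Definition quad_poly (R : nzRingType) (a r : R) : {poly R} :=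
  'X^2 - (2 * a) *: 'X + (r ^+ 2)%:P.

(** The cross product matrix of [w] kills [w], hence commutes with [w w^T]: [K] is normal, with
    eigenvalue [t + a = beta] on [w] and [a + ib], [a - ib] on its orthogonal complement. The bounds
    on the weights say that the corner is at least [S], that the border [u - v] is nonnegative, and
    that the lower right block dominates [B], whose entries are at most [r'] in absolute value. *)
Lemma realizable_complex_pair (R : rcfType) (m : nat) (l S a b r a' b' r' : R)
    (p q : {poly R}) :
  0 <= S -> 0 < b -> 0 <= r -> a ^+ 2 + b ^+ 2 = r ^+ 2 ->
  0 < b' -> 0 <= r' -> a' ^+ 2 + b' ^+ 2 = r' ^+ 2 -> realizable m l S p q ->
  realizable (m + 2) l (S + 2 * r + 2 * r') (p * quad_poly a r) (q * quad_poly a' r').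
Proof.
move=> S0 b0 r0 abr b'0 r'0 abr' hr beta Sbeta.
pose S1 := beta - 2 * r - 2 * r'.
have S1S : S <= S1 by rewrite /S1; lra.
pose t := beta - a.
have tE : t = S1 + 2 * r + 2 * r' - a by rewrite /t /S1; ring.
have betaE : beta = t + a by rewrite /t; ring.
have [w0 [w1 []]] := exists_mixing_weights tE b0 r0 abr r'0 (le_trans S0 S1S).
move=> -[w0_ge0 w1_ge0] wE [h1 h2] h3 h4.
pose u := t * w0 * w1; pose v := b * w1; pose s := t * w1 ^+ 2; pose y := b * w0.
rewrite -/s -/y in h3 h4.
pose K : 'M[R]_(1 + 2) := mx_of_rows 3 3
  [:: [:: t * w0 ^+ 2 + a; u - v; u + v];
      [:: u + v; s + a; s - y];
      [:: u - v; s + y; s + a]].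
pose w : 'cV[R]_(1 + 2) := mx_of_rows 3 1 [:: [:: w0]; [:: w1]; [:: w1]].
pose B : 'M[R]_2 := mx_of_rows 2 2 [:: [:: a'; b']; [:: - b'; a']].
have w0E : w0 ^+ 2 = 1 - 2 * w1 ^+ 2 by lra.
have charB : char_poly B = quad_poly a' r'.
  rewrite char_poly2 !mxE /= /quad_poly -abr' -mul_polyC.
  by rewrite !(rmorphD, rmorphB, rmorphN, rmorphM, rmorphXn, rmorph_nat) /=; ring.
have a'r' : `|a'| <= r' by rewrite ler_norml; apply/andP; split; nra.
have b'r' : `|b'| <= r' by rewrite ler_norml; apply/andP; split; nra.
have uv : v <= u by rewrite /u /v ler_wpM2r.
have v0 : 0 <= v by rewrite mulr_ge0 // ltW.
have y0 : 0 <= y by rewrite mulr_ge0 // ltW.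
rewrite -charB.
apply: (@realizable_glue _ m 2 l S beta p q (quad_poly a r) K B w hr).
- by rewrite mxE /=; apply: le_trans h1.
- apply/matrixP => -[[|[|[|//]]] ?] [[|[|[|//]]] ?];
  rewrite !mxE !big_ord_recl !big_ord0 !mxE /= /u /v /s /y; ring: w0E.
- by apply/matrixP => -[[|[|//]] ?] [[|[|//]] ?];
  rewrite !mxE !big_ord_recl !big_ord0 !mxE /=; ring.
- move=> [[|[|[|//]]] ?] [[|[|[|//]]] ?]; rewrite !mxE /=; lra.
- split.
  + apply/matrixP => -[[|[|[|//]]] ?] j; rewrite !mxE !big_ord_recl big_ord0 !mxE !ord1 /=;
    rewrite betaE /u /v /s /y; ring: w0E.
  + apply/matrixP => -[[|[|[|//]]] ?] j; rewrite !mxE !big_ord_recl big_ord0 !mxE !ord1 /=;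
    rewrite betaE /u /v /s /y; ring: w0E.
  + apply/matrixP => i j; rewrite !mxE !big_ord_recl big_ord0 !mxE !ord1 /=.
    by rewrite ?eqxx ?mulr1n; ring: w0E.
  + by move=> [[|[|[|//]]] ?] j; rewrite !mxE ord1 /=.
- by move=> [[|[|//]] ?] [[|[|//]] ?]; rewrite !mxE /= ?normrN; lra.
- have w0PE : w0%:P ^+ 2 = 1 - 2 * w1%:P ^+ 2 :> {poly R}.
    by rewrite -!rmorphXn /= w0E !(rmorphB, rmorphM, rmorph_nat).
  rewrite char_poly3 !mxE !inordK //= betaE /quad_poly -abr -mul_polyC /u /v /s /y.
  rewrite !(rmorphD, rmorphB, rmorphN, rmorphM, rmorphXn, rmorph_nat) /=; ring: w0PE.
Qed.

(** * The reverse identity, and assembly of the two blocks *)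

Lemma mul_revid_mxE (R : pzRingType) (a b : nat) (X : 'M[R]_(a, b)) i j :
  (revid R a *m X) i j = X (rev_ord i) j.
Proof.
rewrite mxE (bigD1 (rev_ord i)) //= big1 => [|k /eqP ki]; rewrite !mxE.
  by rewrite (_ : (_ == _) = true) ?mul1r ?addr0 //=; have := ltn_ord i; lia.
rewrite (_ : (_ == _) = false) ?mul0r //; apply/negP => /eqP e; apply: ki.
by apply/val_inj => /=; lia.
Qed.

Lemma revidK (R : pzRingType) (a : nat) : revid R a *m revid R a = 1%:M.
Proof.
apply/matrixP => i j; rewrite mul_revid_mxE !mxE /= -val_eqE /=; congr (_%:R).
by have := ltn_ord i; have := ltn_ord j; lia.
Qed.

Lemma tr_revid (R : pzRingType) (a : nat) : (revid R a)^T = revid R a.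
Proof. by apply/matrixP => i j; rewrite !mxE addnC. Qed.

Lemma nonneg_revid (R : numDomainType) (a : nat) : nonneg_mx (revid R a).
Proof. by move=> i j; rewrite mxE ler0n. Qed.

Lemma revid_even (R : pzRingType) (a : nat) :
  revid R (a + a) = block_mx 0 (revid R a) (revid R a) 0.
Proof.
apply/matrixP => i j; case: (split_ordP i) => i' ->; case: (split_ordP j) => j' ->;
(* Zero entries are rewritten as casts of the natural number 0, so that every case compares two
   casts and reduces to index arithmetic. *)
rewrite ?block_mxEul ?block_mxEur ?block_mxEdl ?block_mxEdr !mxE /= -?[0](mulr0n 1);
by congr (_%:R); have := ltn_ord i'; have := ltn_ord j'; lia.
Qed.

Lemma revid_odd (R : pzRingType) (a : nat) :
  revid R (a + (1 + a)) =
  block_mx 0 (row_mx 0 (revid R a)) (col_mx 0 (revid R a)) (block_mx 1%:M 0 0 0).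
Proof.
apply/matrixP => i j; case: (split_ordP i) => i' ->; case: (split_ordP j) => j' ->;
rewrite ?block_mxEul ?block_mxEur ?block_mxEdl ?block_mxEdr;
try (case: (split_ordP i') => i'' ->); try (case: (split_ordP j') => j'' ->);
rewrite ?block_mxEul ?block_mxEur ?block_mxEdl ?block_mxEdr
  ?row_mxEl ?row_mxEr ?col_mxEu ?col_mxEd !mxE ?ord1 /= -?[0](mulr0n 1);
congr (_%:R); try have := ltn_ord i'; try have := ltn_ord j';
try have := ltn_ord i''; try have := ltn_ord j''; rewrite /=; lia.
Qed.

(** The columns of [V] and [W] form orthonormal bases of the vectors fixed and negated by [J]. Thus
    [Q] is orthogonally similar to the direct sum of [P] and [M], and the two signs produced by [J]
    around [M] cancel. The size [N] is kept apart from [a + b] because the odd case orders its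
    summands differently. *)
Lemma sym_skew_assembly (R : comNzRingType) (a b N : nat) (V : 'M[R]_(N, a))
    (W : 'M[R]_(N, b)) (P : 'M[R]_a) (M : 'M[R]_b) :
  (a + b = N)%N -> V^T *m V = 1%:M -> W^T *m W = 1%:M -> V^T *m W = 0 ->
  revid R N *m V = V -> revid R N *m W = - W ->
  normal_real_mx P -> normal_real_mx M ->
  let Q := V *m P *m V^T + W *m M *m W^T in
  [/\ normal_real_mx Q, centrosymmetric Q & char_poly Q = char_poly P * char_poly M].
Proof.
move=> e; case: N / e V W => V W VV WW VW JV JW nP nM Q.
have WV : W^T *m V = 0 by rewrite -[W^T *m V]trmxK trmx_mul trmxK VW trmx0.
split.
- have QT : Q^T = V *m P^T *m V^T + W *m M^T *m W^T.
    by rewrite /Q linearD /= !trmx_mul !trmxK !mulmxA.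
  rewrite /normal_real_mx QT /Q !mulmxDl !mulmxDr !mulmxA.
  rewrite -!(mulmxA _ V^T V) -!(mulmxA _ V^T W) -!(mulmxA _ W^T V) -!(mulmxA _ W^T W).
  rewrite VV WW VW WV !mulmx1 !mulmx0 !mul0mx !addr0 !add0r.
  by rewrite -!(mulmxA V) -!(mulmxA W) nP nM.
- have VJ : V^T *m revid R (a + b) = V^T by rewrite -tr_revid -trmx_mul JV.
  have WJ : W^T *m revid R (a + b) = - W^T by rewrite -tr_revid -trmx_mul JW linearN.
  rewrite /centrosymmetric /Q mulmxDr mulmxDl !mulmxA JV JW.
  by rewrite -!(mulmxA _ _ (revid _ _)) VJ WJ !mulNmx mulmxN opprK.
have -> : Q = row_mx V W *m block_mx P 0 0 M *m (row_mx V W)^T.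
  by rewrite mul_row_block !mulmx0 addr0 add0r tr_row_mx mul_row_col.
rewrite char_poly_conj ?char_poly_block_diag //.
by rewrite tr_row_mx mul_col_row VV VW WV WW -scalar_mx_block.
Qed.

Definition half_sqrt (R : rcfType) : R := Num.sqrt 2^-1.

Lemma half_sqrtE (R : rcfType) : half_sqrt R * half_sqrt R = 2^-1.
Proof. by rewrite -expr2 sqr_sqrtr // invr_ge0 ler0n. Qed.

(** In the bases [(J, 1)] and [(-J, 1)], scaled by the inverse square root of 2, the blocks of [Q]
    are halves of [P + M] and [P - M] up to factors [J]. Domination makes both nonnegative. *)
Lemma centrosymmetric_even (R : rcfType) (a : nat) (P M : 'M[R]_a) :
  normal_real_mx P -> normal_real_mx M -> (forall i j, `|M i j| <= P i j) ->
  exists Q : 'M[R]_(a + a), [/\ normal_real_mx Q, centrosymmetric Q, nonneg_mx Q &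
    char_poly Q = char_poly P * char_poly M].
Proof.
move=> nP nM MP; set h := half_sqrt R; set J := revid R a.
have JJ : J *m J = 1%:M := revidK R a.
have JT : J^T = J := tr_revid R a.
have J0 : nonneg_mx J := @nonneg_revid R a.
pose V : 'M[R]_(a + a, a) := h *: col_mx J 1%:M.
pose W : 'M[R]_(a + a, a) := h *: col_mx (- J) 1%:M.
have half : (2^-1 : R) *: 1%:M + 2^-1 *: 1%:M = 1%:M :> 'M_a.
  by rewrite -scalerDl (_ : _ + _ = 1) ?scale1r //; field.
have D0 : nonneg_mx (P - M).
  by move=> i j; rewrite !mxE subr_ge0; apply: le_trans (ler_norm _) (MP i j).
have S0 : nonneg_mx (P + M).
  move=> i j; rewrite !mxE -lerBlDr sub0r; apply: le_trans (MP i j).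
  by rewrite -normrN ler_norm.
have VT : V^T = h *: row_mx J 1%:M by rewrite /V linearZ /= tr_col_mx JT trmx1.
have WT : W^T = h *: row_mx (- J) 1%:M.
  by rewrite /W linearZ /= tr_col_mx linearN /= JT trmx1.
have [||||||||] := @sym_skew_assembly R a a (a + a) V W P M => //.
- rewrite VT /V -scalemxAl -scalemxAr scalerA half_sqrtE mul_row_col JJ mulmx1.
  by rewrite scalerDr half.
- rewrite WT /W -scalemxAl -scalemxAr scalerA half_sqrtE mul_row_col mulmxN mulNmx opprK.
  by rewrite JJ mulmx1 scalerDr half.
- rewrite VT /W -scalemxAl -scalemxAr scalerA mul_row_col mulmxN JJ mulmx1 addNr.
  by rewrite scaler0.
- by rewrite revid_even /V -scalemxAr mul_block_col !mul0mx mulmx1 JJ addr0 add0r.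
- rewrite revid_even /W -scalemxAr mul_block_col !mul0mx mulmx1 mulmxN JJ addr0 add0r.
  by rewrite -scalerN opp_col_mx opprK.
move=> nQ cQ charQ; exists (V *m P *m V^T + W *m M *m W^T); split=> //.
have -> : V *m P *m V^T + W *m M *m W^T =
    2^-1 *: block_mx (J *m (P + M) *m J) (J *m (P - M)) ((P - M) *m J) (P + M).
  rewrite VT WT /V /W -!scalemxAl -!scalemxAr !scalerA half_sqrtE -scalerDr.
  rewrite (mul_col_mx _ _ P) (mul_col_mx _ _ M) !mul1mx !mul_col_row !mulmx1 add_block_mx.
  rewrite !mulNmx !mulmxN !opprK -!mulmxDl -mulmxDr.
  by rewrite mulmxBr mulmxBl.
move=> i j; rewrite mxE mulr_ge0 // ?invr_ge0 //.
by apply: nonneg_block_mx => //; do ?apply: nonneg_mul_mx.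
Qed.

(** The central basis vector is fixed by [J] and becomes the first column of [V]. The first row and
    column of [P] therefore reach [Q] without meeting [M], and only the lower right block of [P] has
    to dominate [M]. *)
Lemma centrosymmetric_odd (R : rcfType) (a : nat) (P : 'M[R]_(1 + a)) (M : 'M[R]_a) :
  normal_real_mx P -> normal_real_mx M -> nonneg_mx P ->
  (forall i j, `|M i j| <= P (rshift 1 i) (rshift 1 j)) ->
  exists Q : 'M[R]_(a + (1 + a)), [/\ normal_real_mx Q, centrosymmetric Q, nonneg_mx Q &
    char_poly Q = char_poly P * char_poly M].
Proof.
move=> nP nM P0 MP; set h := half_sqrt R; set J := revid R a.
have h0 : 0 <= h := sqrtr_ge0 _.
have JJ : J *m J = 1%:M := revidK R a.
have JT : J^T = J := tr_revid R a.
have J0 : nonneg_mx J := @nonneg_revid R a.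
pose V : 'M[R]_(a + (1 + a), 1 + a) := col_mx (row_mx 0 (h *: J)) (block_mx 1%:M 0 0 h%:M).
pose W : 'M[R]_(a + (1 + a), a) := col_mx (- (h *: J)) (col_mx 0 h%:M).
have half : (2^-1 : R)%:M + 2^-1%:M = 1%:M :> 'M_a.
  by rewrite -raddfD /= (_ : _ + _ = 1) //; field.
have VT : V^T = row_mx (col_mx 0 (h *: J)) (block_mx 1%:M 0 0 h%:M).
  rewrite /V tr_col_mx tr_row_mx tr_block_mx !trmx0 trmx1 tr_scalar_mx.
  by rewrite linearZ /= JT.
have WT : W^T = row_mx (- (h *: J)) (row_mx 0 h%:M).
  by rewrite /W !tr_col_mx tr_scalar_mx trmx0 linearN linearZ /= JT.
have hJhJ : h *: J *m (h *: J) = 2^-1%:M.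
  by rewrite -scalemxAl -scalemxAr scalerA half_sqrtE JJ scalemx1.
have hh : (h%:M : 'M_a) *m h%:M = 2^-1%:M by rewrite -scalar_mxM half_sqrtE.
have [||||||||] := @sym_skew_assembly R (1 + a) a (a + (1 + a)) V W P M => //.
- by rewrite addnC.
- rewrite VT /V mul_row_col mul_col_row mulmx_block !mul0mx !mulmx0 !mulmx1 !addr0 !add0r.
  by rewrite add_block_mx !add0r hJhJ hh half -scalar_mx_block.
- rewrite WT /W mul_row_col mul_row_col mulmx0 add0r hh mulmxN mulNmx opprK hJhJ.
  exact: half.
- rewrite VT /W mul_row_col mul_col_mx mul_block_col !mul0mx !mulmx0 !addr0 add0r.
  by rewrite mulmxN hJhJ hh add_col_mx addr0 addNr col_mx0.
- rewrite revid_odd /V mul_block_col mul_row_block mul_col_row mulmx_block.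
  rewrite !mul0mx !mulmx0 !mulmx1 -!scalemxAr JJ !addr0 !add0r.
  by rewrite add_block_mx !addr0 add0r scalemx1 mul_mx_scalar.
- rewrite revid_odd /W mul_block_col mul_row_col mul_col_mx mul_block_col.
  rewrite !mul0mx !mulmx0 !addr0 !add0r mulmxN -scalemxAr JJ mul_mx_scalar scalemx1.
  by rewrite add_col_mx !addr0 !opp_col_mx opprK oppr0.
move=> nQ cQ charQ; exists (V *m P *m V^T + W *m M *m W^T); split=> //.
set x := dlsubmx P; set y := ursubmx P; set K := drsubmx P.
have D0 : nonneg_mx (K - M).
  by move=> i j; rewrite !mxE subr_ge0; apply: le_trans (ler_norm _) (MP i j).
have S0 : nonneg_mx (K + M).
  move=> i j; rewrite !mxE -lerBlDr sub0r; apply: le_trans (MP i j).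
  by rewrite -normrN ler_norm.
have x0 : nonneg_mx x by move=> i j; rewrite !mxE.
have y0 : nonneg_mx y by move=> i j; rewrite !mxE.
have p0 : nonneg_mx (ulsubmx P) by move=> i j; rewrite !mxE.
have hZ (b c : nat) (X : 'M[R]_(b, c)) (z : R) : 0 <= z -> nonneg_mx X -> nonneg_mx (z *: X).
  by move=> z0 X0 i j; rewrite mxE mulr_ge0.
have half0 : 0 <= 2^-1 :> R by rewrite invr_ge0.
have -> : V *m P *m V^T + W *m M *m W^T =
    block_mx (2^-1 *: (J *m (K + M) *m J))
      (row_mx (h *: (J *m x)) (2^-1 *: (J *m (K - M))))
      (col_mx (h *: (y *m J)) (2^-1 *: ((K - M) *m J)))
      (block_mx (ulsubmx P) (h *: y) (h *: x) (2^-1 *: (K + M))).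
  have VP : V *m P = col_mx (row_mx (h *: (J *m x)) (h *: (J *m K)))
      (block_mx (ulsubmx P) y (h *: x) (h *: K)).
    rewrite -[in LHS](submxK P) mul_col_mx mul_row_block mulmx_block.
    by rewrite !mul0mx !mul1mx !mul_scalar_mx -!scalemxAl !addr0 !add0r.
  have WM : W *m M = col_mx (- (h *: (J *m M))) (col_mx 0 (h *: M)).
    by rewrite !mul_col_mx mul0mx mul_scalar_mx mulNmx -scalemxAl.
  rewrite VP WM VT WT !mul_col_row mul_row_col mul_row_block mul_block_col mulmx_block.
  rewrite mul_mx_row mul_col_mx !mulmx0 !mul0mx !mulmx1 !addr0 !add0r.
  rewrite !mul_mx_scalar !mulmxN !mulNmx !opprK -!scalemxAl -!scalemxAr !scalerA half_sqrtE.
  rewrite add_block_mx add_row_mx add_col_mx add_block_mx !addr0 ?scalerN ?scalerA.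
  rewrite ?half_sqrtE -!scalerDr -!scalerBr.
  by rewrite !mulmxDr ?mulmxDl mulmxN mulNmx.
have nn_row (b c d : nat) (X : 'M[R]_(b, c)) (Y : 'M[R]_(b, d)) :
    nonneg_mx X -> nonneg_mx Y -> nonneg_mx (row_mx X Y).
  move=> X0 Y0 i j; case: (split_ordP j) => k ->; by rewrite ?row_mxEl ?row_mxEr.
have nn_col (b c d : nat) (X : 'M[R]_(b, c)) (Y : 'M[R]_(d, c)) :
    nonneg_mx X -> nonneg_mx Y -> nonneg_mx (col_mx X Y).
  move=> X0 Y0 i j; case: (split_ordP i) => k ->; by rewrite ?col_mxEu ?col_mxEd.
by apply: nonneg_block_mx; [| apply: nn_row | apply: nn_col | apply: nonneg_block_mx];
  do ?apply: hZ => //; do ?apply: nonneg_mul_mx.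
Qed.

(** * Induction on the eigenvalues, and conclusion *)

Lemma big_ord_double (T : Type) (idx : T) (op : Monoid.com_law idx) (k : nat) (F : nat -> T) :
  \big[op/idx]_(i < 2 * k) F i =
  op (\big[op/idx]_(i < k) F (2 * i)%N) (\big[op/idx]_(i < k) F (2 * i).+1).
Proof.
rewrite -big_split /=; elim: k => [|k IHk]; first by rewrite muln0 !big_ord0.
by rewrite mulnSr addn2 !big_ord_recr /= IHk Monoid.mulmA.
Qed.

(** Eigenvalues of even index go to [P], those of odd index to [M]. *)
Lemma realizable_real_pairs (R : rcfType) (l : R) (f : nat -> R) (k : nat) :
  0 <= l -> (forall i, f i < 0) ->
  realizable k l (l - \sum_(i < 2 * k) f i)
    (\prod_(i < k) ('X - (f (2 * i)%N)%:P)) (\prod_(i < k) ('X - (f (2 * i).+1)%:P)).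
Proof.
move=> l0 f0; elim: k => [|k IHk].
  move=> alpha; rewrite muln0 !big_ord0 subr0 => la.
  (* The induction starts from the 1 x 1 block [alpha] and an empty [M]. *)
  exists (alpha%:M : 'M_1), 0; split.
  - by rewrite /normal_real_mx tr_scalar_mx trmx0.
  - by split; [move=> i j; rewrite !ord1 mxE eqxx mulr1n (le_trans l0)
              | rewrite mxE eqxx mulr1n].
  - by case.
  - exists 1%:M; split; rewrite ?tr_scalar_mx ?mul1mx ?mulmx1 ?scalemx1 //.
    by move=> i j; rewrite !ord1 mxE eqxx.
  - by rewrite char_poly_scalar1 mulr1 /char_poly det_mx00.
have := realizable_real_pair _ (f0 (2 * k)%N) (f0 (2 * k).+1) IHk.
rewrite mulnSr addn2 !big_ord_recr /= addn1.
have -> : l - (\sum_(i < 2 * k) f i + f (2 * k)%N + f (2 * k).+1) =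
  l - \sum_(i < 2 * k) f i - f (2 * k)%N - f (2 * k).+1 by ring.
apply.
rewrite addr_ge0 // oppr_ge0 sumr_le0 // => i _; exact: ltW.
Qed.

Lemma realizable_complex_pairs (R : rcfType) (m : nat) (l S : R) (p q : {poly R})
    (a b r : nat -> R) (s : nat) :
  0 <= S -> (forall i, 0 < b i) -> (forall i, 0 <= r i) ->
  (forall i, a i ^+ 2 + b i ^+ 2 = r i ^+ 2) -> realizable m l S p q ->
  realizable (m + 2 * s) l (S + \sum_(i < 2 * s) 2 * r i)
    (p * \prod_(i < s) quad_poly (a (2 * i)%N) (r (2 * i)%N))
    (q * \prod_(i < s) quad_poly (a (2 * i).+1) (r (2 * i).+1)).
Proof.
move=> S0 b0 r0 abr hr; elim: s => [|s IHs].
  by rewrite muln0 !big_ord0 addn0 addr0 !mulr1.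
have := realizable_complex_pair _ (b0 (2 * s)%N) (r0 (2 * s)%N) (abr (2 * s)%N)
  (b0 (2 * s).+1) (r0 (2 * s).+1) (abr (2 * s).+1) IHs.
rewrite mulnSr addnA !addn2 !big_ord_recr /= !mulrA.
have -> : S + (\sum_(i < 2 * s) 2 * r i + 2 * r (2 * s)%N + 2 * r (2 * s).+1) =
  S + \sum_(i < 2 * s) 2 * r i + 2 * r (2 * s)%N + 2 * r (2 * s).+1 by ring.
apply.
by rewrite addr_ge0 // sumr_ge0 // => i _; rewrite mulr_ge0.
Qed.

(** The leftover eigenvalue [mu] completes [M] to a block of the size of [P]; the corner bound on
    [P 0 0] dominates it. *)
Lemma sym_skew_pair_even (R : rcfType) (m : nat) (mu alpha : R) (p q : {poly R}) P M :
  @sym_skew_pair R m `|mu| alpha p q P M ->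
  exists Q : 'M[R]_((1 + m) + (1 + m)),
    [/\ normal_real_mx Q, centrosymmetric Q, nonneg_mx Q &
        char_poly Q = ('X - alpha%:P) * p * (('X - mu%:P) * q)].
Proof.
case=> [[nP nM] [P0 Pmu] MP _ [charP charM]].
have [|||Q [nQ cQ Q0 charQ]] := @centrosymmetric_even R (1 + m) P (block_mx mu%:M 0 0 M).
- done.
- rewrite /normal_real_mx tr_block_mx !mulmx_block !trmx0 !mulmx0 !mul0mx tr_scalar_mx.
  by rewrite !addr0 !add0r nM.
- move=> i j; case: (split_ordP i) => i' ->; case: (split_ordP j) => j' ->;
  rewrite ?block_mxEul ?block_mxEur ?block_mxEdl ?block_mxEdr //.
  + rewrite !ord1 mxE eqxx mulr1n.
    by have -> : lshift m 0 = 0 :> 'I_(1 + m) by apply: val_inj.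
  + by rewrite mxE normr0.
  + by rewrite mxE normr0.
exists Q; split=> //.
by rewrite charQ char_poly_block_diag charP charM char_poly_scalar1.
Qed.

Lemma sym_skew_pair_odd (R : rcfType) (m : nat) (l alpha : R) (p q : {poly R}) P M :
  @sym_skew_pair R m l alpha p q P M ->
  exists Q : 'M[R]_(m + (1 + m)),
    [/\ normal_real_mx Q, centrosymmetric Q, nonneg_mx Q &
        char_poly Q = ('X - alpha%:P) * p * q].
Proof.
case=> [[nP nM] [P0 _] MP _ [charP charM]].
have [Q [nQ cQ Q0 charQ]] := centrosymmetric_odd nP nM P0 MP.
by exists Q; split=> //; rewrite charQ charP charM.
Qed.

Lemma normal_centrosymmetric_exists (R : rcfType) (n s : nat) (lam a b r : nat -> R) :
  0 <= lam 0%N -> (forall i, lam i.+1 < 0) -> (forall i, 0 < b i) -> (forall i, 0 <= r i) ->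
  (forall i, a i ^+ 2 + b i ^+ 2 = r i ^+ 2) ->
  0 <= \sum_(i < n.+1) lam i - 2 * \sum_(i < 2 * s) r i ->
  exists Q : 'M[R]_(n + 4 * s + 1),
    [/\ normal_real_mx Q, centrosymmetric Q, nonneg_mx Q &
        char_poly Q = \prod_(i < n.+1) ('X - (lam i)%:P) *
          \prod_(j < 2 * s) quad_poly (a j) (r j)].
Proof.
move=> lam0 lamN b0 r0 abr hsum.
rewrite big_ord_recl /= in hsum.
(* For even [n] the negative eigenvalues pair up and the final size is odd, with [l = 0]. For odd
   [n] one of them, [lam 1], stays unpaired and fills the corner of [M], with [l] its absolute
   value. In both cases the sum hypothesis says that the Perron root [lam 0] reaches the required
   bound. *)
have [k [nk|nk]] : exists k, n = (2 * k)%N \/ n = (2 * k).+1 by exists n./2; lia.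
  have h : realizable _ _ _ _ _ := @realizable_real_pairs R 0 (fun i => lam i.+1) k (lexx _) lamN.
  have S0 : 0 <= 0 - \sum_(i < 2 * k) lam i.+1.
    by rewrite sub0r oppr_ge0 sumr_le0 // => i _; apply: ltW.
  have [|P [M /sym_skew_pair_odd [Q [nQ cQ Q0 charQ]]]] :=
    realizable_complex_pairs (s := s) S0 b0 r0 abr h (alpha := lam 0%N) _.
    by rewrite -mulr_sumr; subst n; rewrite /bump /= in hsum; lra.
  rewrite (_ : n + 4 * s + 1 = (k + 2 * s) + (1 + (k + 2 * s)))%N; last by lia.
  exists Q; split=> //; rewrite charQ nk big_ord_recl
    (big_ord_double _ s (fun j => quad_poly (a j) (r j))) /=.
  rewrite (big_ord_double _ k (fun i => 'X - (lam i.+1)%:P)) /=.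
  by ring.
have lam10 : lam 1%N <= 0 := ltW (lamN 0%N).
have h := @realizable_real_pairs R `|lam 1%N| (fun i => lam i.+2) k
  (normr_ge0 _) (fun i => lamN i.+1).
have S0 : 0 <= `|lam 1%N| - \sum_(i < 2 * k) lam i.+2.
  by rewrite addr_ge0 // oppr_ge0 sumr_le0 // => i _; apply: ltW.
have [|P [M /sym_skew_pair_even [Q [nQ cQ Q0 charQ]]]] :=
  realizable_complex_pairs (s := s) S0 b0 r0 abr h (alpha := lam 0%N) _.
  rewrite -mulr_sumr ler0_norm //; subst n; rewrite big_ord_recl /bump /= in hsum.
  by rewrite /bump /= in hsum; lra.
rewrite (_ : n + 4 * s + 1 = (1 + (k + 2 * s)) + (1 + (k + 2 * s)))%N; last by lia.
exists Q; split=> //; rewrite charQ nk !big_ord_recl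
    (big_ord_double _ s (fun j => quad_poly (a j) (r j))) /=.
rewrite (big_ord_double _ k (fun i => 'X - (lam i.+2)%:P)) /=.
by ring.
Qed.

Lemma map_quad_poly (R : rcfType) (z : R[i]) (r : R) :
  complex.Re z ^+ 2 + complex.Im z ^+ 2 = r ^+ 2 ->
  map_poly (real_complex R) (quad_poly (complex.Re z) r) =
  ('X - z%:P) * ('X - (z^*)%C%:P).
Proof.
move=> zr; rewrite /quad_poly -mul_polyC rmorphD rmorphB /= map_polyXn rmorphM /= map_polyX.
rewrite !map_polyC /=.
have -> : real_complex R (2 * complex.Re z) = z + (z^*)%C.
  by case: z zr => x y _; apply/eqP; rewrite eq_complex /=; apply/andP; split; apply/eqP; ring.
have -> : real_complex R (r ^+ 2) = z * (z^*)%C.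
  rewrite -zr; case: z {zr} => x y; apply/eqP; rewrite eq_complex /=.
  by apply/andP; split; apply/eqP; ring.
by rewrite rmorphD rmorphM /=; ring.
Qed.

Theorem theorem3p11 (R : realType) (n s : nat) (hn : (1 <= n)%N) (hs : (1 <= s)%N)
    (lam : 'I_n.+1 -> R) (z : 'I_(2 * s) -> R[i])
    (hl0 : 0 <= lam ord0)
    (hl1 : forall i : 'I_n.+1, (0 < i)%N -> lam i < 0)
    (hmon : forall i j : 'I_n.+1, (0 < i)%N -> (i <= j)%N -> lam j <= lam i)
    (hz : forall j, 0 < complex.Im (z j))
    (hsum : 0 <= ((\sum_(i < n.+1) lam i)%:C)%C - 2 * \sum_(j < 2 * s) `|z j|) :
  exists Q : 'M[R]_(n + 4 * s + 1),
    [/\ normal_real_mx Q, centrosymmetric Q, nonneg_mx Q &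
        char_poly (map_mx (real_complex R) Q) =
          \prod_(i < n.+1) ('X - ((lam i)%:C)%C%:P) *
          \prod_(j < 2 * s) (('X - (z j)%:P) * ('X - ((z j)^*)%C%:P))].
Proof.
(* The families are extended to all natural numbers; the defaults -1 and [i] keep the extended
   values negative, respectively with positive imaginary part. *)
pose lam' i := oapp lam (-1) (insub i); pose z' j := oapp z 'i%C (insub j).
have lamE (i : 'I_n.+1) : lam i = lam' i by rewrite /lam' valK.
have zE j : z j = z' j by rewrite /z' valK.
have lamN i : lam' i.+1 < 0.
  rewrite /lam'; case: insubP => [j _ jE|_] /=; last by rewrite ltrN10.
  by apply: hl1; rewrite jE.
have z0 j : 0 < complex.Im (z' j).
  by rewrite /z'; case: insubP => [k _ _|_] /=; [exact: hz | rewrite ltr01].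
pose r j := Num.sqrt (complex.Re (z' j) ^+ 2 + complex.Im (z' j) ^+ 2).
have rE j : complex.Re (z' j) ^+ 2 + complex.Im (z' j) ^+ 2 = r j ^+ 2.
  by rewrite sqr_sqrtr // addr_ge0 ?sqr_ge0.
have [||||Q [nQ cQ Q0 charQ]] := @normal_centrosymmetric_exists R n s lam'
  (fun j => complex.Re (z' j)) (fun j => complex.Im (z' j)) r _ lamN z0.
- by rewrite (lamE ord0) in hl0.
- by move=> j; apply: sqrtr_ge0.
- exact: rE.
(* The hypothesis is an inequality between complex numbers; writing the moduli as real square roots
   brings it back to the real field. *)
- have e : \sum_(j < 2 * s) `|z j| = ((\sum_(j < 2 * s) r j)%:C)%C.
    by rewrite rmorph_sum; apply: eq_bigr => j _; rewrite normc_def zE.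
  rewrite e (eq_bigr _ (fun i _ => lamE i)) in hsum.
  rewrite -ler0c rmorphB rmorphM rmorph_nat; exact: hsum.
exists Q; split=> //.
rewrite -map_char_poly charQ rmorphM !rmorph_prod /=; congr (_ * _); apply: eq_bigr => i _.
  by rewrite map_polyXsubC lamE.
by rewrite map_quad_poly // zE.
Qed.
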